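(* Let $l>1/2$ and let $V\ge0$, $V\in L_{(2l+1)/(2l)}(0,2\pi)$, be a $2\pi$-periodic potential. Let $A_V$ be the self-adjoint operator with discrete spectrum defined by the quadratic form $$\int_0^{2\pi}\varphi^{(l)}(x)^2\,dx-\int_0^{2\pi}V(x)\varphi(x)^2\,dx,\qquad \varphi\in\dot H^l(\mathbb{S}^1).$$ Suppose that there exist $N$ negative eigenvalues $-\nu_j\le0$, $j=1,\dots,N$, of $A_V$ (counted with multiplicity). Then both the negative trace and the number $N$ of negative eigenvalues satisfy $$\sum_{j=1}^N\nu_j+N\cdot\biggl(\frac{K(l)}{c(l)}\biggr)^{2l}\le\frac{2l}{(2l+1)^{\frac{2l+1}{2l}}}\cdot c(l)\int_0^{2\pi}V(x)^{\frac{2l+1}{2l}}\,dx .$$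
   Context: $\dot H^l(\mathbb{S}^1)$ is the Sobolev space of $2\pi$-periodic functions with mean value zero, $\|\cdot\|$ is the norm of $L_2(0,2\pi)$, and $\varphi^{(l)}$ is the derivative of order $l$ (for non-integer $l$, understood as $(-d^2/dx^2)^{l/2}\varphi$). The operator $A_V$ acts in the mean-zero subspace of $L_2(0,2\pi)$; for $l=1$ it is $-\varphi''-\Pi(V\varphi)$, where $\Pi f=f-\frac1{2\pi}\int_0^{2\pi}f\,dx$. The constant $c(l)$ is $$c(l)=\bigl(2l\,\alpha^\alpha(1-\alpha)^{1-\alpha}\sin\pi\alpha\bigr)^{-1},\qquad \alpha=\frac1{2l},$$ which is the sharp constant in $\|f\|_\infty^2\le c(l)\|f\|^{2-1/l}\|f^{(l)}\|^{1/l}$ for $f\in\dot H^l(\mathbb{S}^1)$. The constant $K(l)>0$ is the sharp (largest) constant such that $$\|f\|_\infty^2\le c(l)\|f\|^{2-1/l}\|f^{(l)}\|^{1/l}-K(l)\|f\|^2\qquad\text{for all } f\in\dot H^l(\mathbb{S}^1);$$ this inequality, and the positivity of $K(l)$, are known results (Bartuccelli, Deane, Zelik). In particular $c(1)=1$, $K(1)=1/\pi$, and $c(2)=(4/27)^{1/4}$, $K(2)=2/(3\pi)$. *)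

(* Defs.v *)
From HB Require Import structures.
From mathcomp Require Import all_boot all_order all_algebra.
From mathcomp Require Import all_classical all_reals all_analysis.

Set Implicit Arguments.
Unset Strict Implicit.
Unset Printing Implicit Defensive.

Import Order.TTheory GRing.Theory Num.Theory.
Import numFieldNormedType.Exports.

Local Open Scope classical_set_scope.
Local Open Scope ring_scope.

(* Functions on the circle are 2pi-periodic functions R -> R, identified when
   they agree almost everywhere; integrals and norms are over one period. *)
Section Circle.
Context {R : realType}.
Implicit Types (f g phi psi V : R -> R) (l K : R).

Definition circle_measure : {measure set (measurableTypeR R) -> \bar R} :=
  mrestr (@lebesgue_measure R) (measurable_itv `]0, 2 * pi[).

Local Notation mu := circle_measure.

Definition Lper (p : R) f := periodic f (2 * pi) /\ f \in Lfun mu p%:E.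

Definition L2dot f := Lper 2 f /\ \int[mu]_x f x = 0.

Definition L2norm f : R := fine 'N[mu]_2[EFin \o f].

Definition smooth_periodic psi :=
  periodic psi (2 * pi) /\ forall (n : nat) (x : R), derivable (derive1n n psi) x 1.

Definition weak_deriv (n : nat) f g :=
  forall psi, smooth_periodic psi ->
    \int[mu]_x (g x * psi x) = (-1) ^+ n * \int[mu]_x (f x * derive1n n psi x).

(* g = (-d^2/dx^2)^(l/2) f: this operator multiplies cos (k x) and sin (k x)
   by (k^2)^(l/2), hence the Fourier coefficients of f by the same factor. *)
Definition frac_deriv l f g :=
  forall k : nat,
    \int[mu]_x (g x * cos (k%:R * x)) =
      (k%:R ^+ 2) `^ (l / 2) * \int[mu]_x (f x * cos (k%:R * x)) /\
    \int[mu]_x (g x * sin (k%:R * x)) =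
      (k%:R ^+ 2) `^ (l / 2) * \int[mu]_x (f x * sin (k%:R * x)).

(* g = f^(l), as an element of L_2; such a g is unique up to null sets. *)
Definition sobolev_deriv l f g :=
  Lper 2 g /\
  if l \is a Num.nat then weak_deriv (Num.truncn l) f g else frac_deriv l f g.

Definition Hdot l f := L2dot f /\ exists g, sobolev_deriv l f g.

Definition c_const l : R :=
  let a := 1 / (2 * l) in
  (2 * l * a `^ a * (1 - a) `^ (1 - a) * sin (pi * a))^-1.

Definition sup_inequality l K :=
  forall f df, Hdot l f -> sobolev_deriv l f df ->
    ('N[mu]_+oo[EFin \o f] ^+ 2 <=
      (c_const l * L2norm f `^ (2 - 1 / l) * L2norm df `^ (1 / l)
        - K * L2norm f ^+ 2)%:E)%E.

(* K = K(l) *)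
Definition is_sharp_const l K :=
  [/\ 0 < K, sup_inequality l K & forall K', sup_inequality l K' -> K' <= K].

(* The polarized quadratic form; dphi and dpsi stand for phi^(l), psi^(l). *)
Definition schroedinger_form V phi dphi psi dpsi : R :=
  \int[mu]_x (dphi x * dpsi x) - \int[mu]_x (V x * phi x * psi x).

(* phi is in the domain of A_V and A_V phi = g, where A_V is the operator in
   the mean-zero subspace of L_2 that represents the quadratic form: phi is in
   the form domain and the form at (phi, psi) is the inner product of g and psi
   for all psi in the form domain. *)
Definition schroedinger_op l V phi g :=
  [/\ Hdot l phi, L2dot g &
    exists2 dphi, sobolev_deriv l phi dphi &
      forall psi dpsi, Hdot l psi -> sobolev_deriv l psi dpsi ->
        schroedinger_form V phi dphi psi dpsi = \int[mu]_x (g x * psi x)].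

Definition ae_independent (n : nat) (phi : 'I_n -> R -> R) :=
  forall xi : 'I_n -> R,
    {ae mu, forall x, \sum_(i < n) xi i * phi i x = 0} -> forall i, xi i = 0.

(* The eigenspace of A_V at lambda has dimension at least n. *)
Definition multiplicity_ge l V (lambda : R) (n : nat) :=
  exists phi : 'I_n -> R -> R,
    (forall i, schroedinger_op l V (phi i) (fun x => lambda * phi i x)) /\
    ae_independent phi.

(* No value is listed more often than its multiplicity; as lambda j is listed at
   least once, every entry is an eigenvalue. *)
Definition eigenvalues_with_mult l V (N : nat) (lambda : 'I_N -> R) :=
  forall j, multiplicity_ge l V (lambda j) #|[set i | lambda i == lambda j]%SET|.

End Circle.

(* Main.v *)
Require Import Defs.
From HB Require Import structures.
From mathcomp Require Import all_boot all_order all_algebra.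
From mathcomp Require Import all_classical all_reals all_analysis.
From mathcomp Require Import ring lra ess_sup_inf measurable_realfun.

Import Order.TTheory GRing.Theory Num.Theory.
Import numFieldNormedType.Exports.

Local Open Scope classical_set_scope.
Local Open Scope ring_scope.

Set Implicit Arguments.
Unset Strict Implicit.
Unset Printing Implicit Defensive.

(** Let phi_1, ..., phi_N be orthonormal eigenfunctions for the eigenvalues
    - nu_j, and put rho(x) = sum_j phi_j(x)^2, a_ij = (phi_i^(l), phi_j^(l)) and
    c = c(l). Summing the values of the quadratic form gives
      sum_j nu_j = int V rho - sum_j a_jj,
    so everything rests on a lower bound of the kinetic energy sum_j a_jj by a
    functional of rho.

    That bound comes from the one-function inequality
      f(x)^2 + K ||f||^2 <= c ||f||^(2 - 1/l) ||f^(l)||^(1/l)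
    applied to f = sum_j xi_j phi_j, where xi is a real vector. By orthonormality
    ||f||^2 = |xi|^2 and ||f^(l)||^2 = sum_ij xi_i xi_j a_ij, so after raising to
    the power 2l,
      ((sum_j xi_j phi_j(x))^2 + K |xi|^2)^(2l)
        <= c^(2l) |xi|^(4l-2) sum_ij xi_i xi_j a_ij.
    The choice xi = phi(x) turns this into
      rho (rho + K)^(2l) <= c^(2l) sum_ij phi_i(x) phi_j(x) a_ij   (almost every x).
    This choice depends on x, while for each xi the inequality is only known off a
    null set that depends on xi. It is therefore taken first for rational xi, which
    are countably many and share one null set, and then extended to all xi by
    continuity: this is [density_inequality], with [rational_directions] for the
    extension.

    Since 2l > 1, (rho + K)^(2l) >= rho^(2l) + K^(2l) ([powR_superadd]), and Young's
    inequality with the optimal weight ([young_potential]) bounds V rho by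
    c^(-2l) rho^(2l+1) plus the integrand of the right-hand side. Together, almost
    everywhere,
      V rho + (K/c)^(2l) rho <= C V^((2l+1)/(2l)) + sum_ij a_ij phi_i phi_j,
    and integrating over the period, with int phi_i phi_j = delta_ij, gives the
    theorem; here C is the constant in front of the integral of V^((2l+1)/(2l)).

    The orthonormal eigenfunctions are obtained eigenvalue by eigenvalue from a
    Gram-Schmidt argument on the Gram matrix ([gram_schmidt]); eigenfunctions for
    different eigenvalues are orthogonal by symmetry of the form. The integral of
    V phi psi converges because functions of the form domain are bounded, which is
    again the one-function inequality. *)

(** * Linear algebra *)

(** Induction on the size: a congruence [P] for the lower right block is completed by
    the first basis vector made orthogonal to the others, which is [v] below, and
    divided by its norm. *)
Lemma gram_schmidt (R : rcfType) (n : nat) (G : 'M[R]_n) :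
  G^T = G -> (forall x : 'rV[R]_n, x != 0 -> 0 < (x *m G *m x^T) 0 0) ->
  exists P : 'M[R]_n, P *m G *m P^T = 1%:M.
Proof.
elim: n G => [|n IH]; first by exists 0; apply/matrixP => -[].
rewrite -[n.+1]/(1 + n)%N => G Gsym Gpos.
pose A : 'M[R]_n := @drsubmx _ 1 n 1 n G; pose b : 'rV[R]_n := @ursubmx _ 1 n 1 n G.
pose d : 'M[R]_1 := @ulsubmx _ 1 n 1 n G.
have GE : G = block_mx d b b^T A :> 'M[R]_(1 + n).
  by rewrite -[LHS](@submxK _ 1 n 1 n) /b trmx_ursub Gsym.
have Asym : A^T = A by rewrite /A trmx_drsub Gsym.
have [x xN0|P PAP] := IH A Asym.
  have := Gpos (row_mx (0 : 'M[R]_1) x : 'rV[R]_(1 + n)).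
  rewrite GE mul_row_block tr_row_mx mul_row_col trmx0 mulmx0 add0r !mul0mx add0r.
  apply; apply: contraNneq xN0 => /(congr1 (@rsubmx _ _ 1 n)).
  by rewrite row_mxKr => ->; rewrite linear0.
(* The coordinates of the first basis vector along the normalized others. *)
pose w := b *m P^T.
pose v : 'rV[R]_(1 + n) := row_mx 1%:M (- (w *m P)).
have bw : P *m b^T = w^T by rewrite /w trmx_mul trmxK.
have vG : v *m G = row_mx (d - w *m w^T) (b - w *m P *m A).
  by rewrite GE mul_row_block !mul1mx !mulNmx -[w *m P *m b^T]mulmxA bw.
have vGP : (b - w *m P *m A) *m P^T = 0.
  by rewrite mulmxBl -!mulmxA [P *m _]mulmxA PAP mulmx1 subrr.
have vN0 : v != 0.
  apply/eqP => /(congr1 (@lsubmx _ _ 1 n)); rewrite row_mxKl linear0.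
  by move=> /matrixP/(_ 0 0)/eqP; rewrite !mxE eqxx oner_eq0.
have := Gpos v vN0; set t := (_ *m _ *m _) 0 0 => t_gt0.
have sE : v *m G *m v^T = t%:M by rewrite [LHS]mx11_scalar.
pose s := (Num.sqrt t)^-1.
exists (col_mx (s *: v) (row_mx (0 : 'M[R]_(n, 1)) P) : 'M[R]_(1 + n)).
have PG : row_mx (0 : 'M[R]_(n, 1)) P *m G = row_mx w^T (P *m A).
  by rewrite GE mul_row_block !mul0mx !add0r bw.
rewrite mul_col_mx tr_col_mx mul_col_row.
rewrite (@scalar_mx_block _ 1 n).
rewrite linearZ /= -!scalemxAl -!scalemxAr sE PG.
have -> : s *: (s *: t%:M) = 1%:M :> 'M[R]_1.
  rewrite scalerA scale_scalar_mx; congr _%:M.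
  by rewrite /s -invfM -expr2 sqr_sqrtr ?ltW// mulVf// gt_eqF.
have vGP0 : v *m G *m (row_mx (0 : 'M[R]_(n, 1)) P)^T = 0.
  by rewrite vG tr_row_mx mul_row_col trmx0 mulmx0 add0r vGP.
rewrite vGP0 scaler0.
have -> : row_mx w^T (P *m A) *m v^T = 0.
  by rewrite -PG -[LHS]trmxK trmx_mul [(_ *m G)^T]trmx_mul trmxK Gsym mulmxA vGP0 trmx0.
rewrite scaler0 tr_row_mx mul_row_col trmx0 mulmx0 add0r PAP //.
Qed.

(** * Inequalities for real powers *)

Lemma powR_superadd (R : realType) (m a b : R) : 1 < m -> 0 <= a -> 0 <= b ->
  a `^ m + b `^ m <= (a + b) `^ m.
Proof.
move=> m1 a0 b0; have m0 : 0 < m by lra.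
have split1 x : 0 <= x -> x `^ m = x * x `^ (m - 1) by move=> ?; rewrite mulr_powRB1.
rewrite !split1 ?addr_ge0// mulrDl.
by apply: lerD; apply: ler_wpM2l => //; apply: ge0_ler_powR; rewrite ?nnegrE; lra.
Qed.

(** Young's inequality for the product of [t * V] and [r / t]. The weight [t] is chosen so
    that the term in [r] has coefficient [c `^ (- 2 l)]; the coefficient of the term in
    [V] is then the constant of the trace bound. *)
Lemma young_potential (R : realType) (l c V r : R) :
  1 / 2 < l -> 0 < c -> 0 <= V -> 0 <= r ->
  V * r <= 2 * l / (2 * l + 1) `^ ((2 * l + 1) / (2 * l)) * c *
      V `^ ((2 * l + 1) / (2 * l)) + (c `^ (2 * l))^-1 * r `^ (2 * l + 1).
Proof.
move=> hl c0 V0 r0; set q := 2 * l + 1; set p := q / (2 * l).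
have l0 : 0 < 2 * l by lra.
have q0 : 0 < q by rewrite /q; lra.
have p0 : 0 < p by rewrite divr_gt0.
pose t := (c `^ (2 * l) / q) `^ q^-1.
have t0 : 0 < t by rewrite powR_gt0// divr_gt0// powR_gt0.
have tq : t `^ q = c `^ (2 * l) / q.
  by rewrite -powRrM mulVf ?gt_eqF// powRr1// divr_ge0 ?powR_ge0// ltW.
have tp : t `^ p = c * q `^ (- (2 * l)^-1).
  rewrite -powRrM /p mulrA mulVf ?gt_eqF// mul1r powRM ?powR_ge0//; last first.
    by rewrite invr_ge0 ltW.
  rewrite -powRrM mulfV ?gt_eqF// powRr1 ?ltW//.
  by rewrite -(powR_inv1 (ltW q0)) -powRrM mulN1r.
have -> : V * r = (t * V) * (r / t) by field; lra.
have tV0 : 0 <= t * V by rewrite mulr_ge0// ltW.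
have rt0 : 0 <= r / t by rewrite divr_ge0// ltW.
have pq : p^-1 + q^-1 = 1 by rewrite /p /q; field; apply/andP; split; lra.
apply: (le_trans (conjugate_powR tV0 rt0 p0 q0 pq)).
have ti0 : 0 <= t^-1 by rewrite invr_ge0 ltW.
rewrite (powRM p (ltW t0) V0) (powRM q r0 ti0) tp.
have -> : t^-1 `^ q = (t `^ q)^-1.
  by rewrite -powR_inv1 ?ltW// powRAC powR_inv1// powR_ge0.
rewrite tq.
have -> : q `^ p = q * q `^ ((2 * l)^-1).
  rewrite /p (_ : q / _ = 1 + (2 * l)^-1); last by rewrite /q; field; lra.
  by rewrite powRD ?powRr1 ?ltW// (gt_eqF q0) implybT.
rewrite powRN le_eqVlt; apply/predU1P; left; rewrite /p.
have ? : q `^ (2 * l)^-1 != 0 by rewrite gt_eqF// powR_gt0.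
have ? : c `^ (2 * l) != 0 by rewrite gt_eqF// powR_gt0.
have ? : 2 * l != 0 by rewrite gt_eqF.
have ? : q != 0 by rewrite gt_eqF.
by field; do ?[apply/andP; split]=> //; lra.
Qed.

(** * From rational to real directions *)

Lemma powR_continuous (R : realType) (a x : R) : 0 < x ->
  {for x, continuous (fun y : R => y `^ a)}.
Proof.
move=> x0; apply: differentiable_continuous; apply/derivable1_diffP.
by apply: derivable_powR; rewrite in_itv /= andbT.
Qed.

Lemma rational_approximation (R : realType) (n : nat) (xi : 'I_n -> R) :
  exists q : nat -> {ffun 'I_n -> rat},
    forall i, (ratr (q k i) : R) @[k --> \oo] --> xi i.
Proof.
have ex k i : exists q : rat, xi i < ratr q < xi i + harmonic k.
  have /rat_in_itvoo[q] : xi i < xi i + harmonic k by rewrite ltrDl harmonic_gt0.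
  by rewrite in_itv; exists q.
have /choice[f fP] : forall ki : nat * 'I_n, exists q : rat,
    xi ki.2 < ratr q < xi ki.2 + harmonic ki.1 by move=> [k i]; exact: ex.
exists (fun k => [ffun i => f (k, i)]) => i.
apply: (@squeeze_cvgr _ _ _ _ (fun=> xi i) (fun k => xi i + harmonic k)).
- apply: nearW => k; rewrite ffunE; have /andP[/= h1 h2] := fP (k, i).
  by rewrite !ltW.
- exact: cvg_cst.
- rewrite -[X in _ --> X]addr0; apply: cvgD; first exact: cvg_cst.
  exact: cvg_harmonic.
Qed.

Lemma cvg_sumr (R : realType) (n : nat) (u : 'I_n -> nat -> R) (a : 'I_n -> R) :
  (forall i, u i k @[k --> \oo] --> a i) ->
  \sum_i u i k @[k --> \oo] --> \sum_i a i.
Proof. by move=> ua; apply: cvg_big => //; exact: add_continuous. Qed.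

(** Both sides are continuous in [xi] away from [xi = 0]; there the bases of the real
    powers are positive, the left one because [K > 0]. *)
Lemma rational_directions (R : realType) (n : nat) (v : 'I_n -> R)
    (a : 'I_n -> 'I_n -> R) (K m C : R) :
  let s (xi : 'I_n -> R) := \sum_i xi i ^+ 2 in
  let ineq xi := ((\sum_i xi i * v i) ^+ 2 + K * s xi) `^ m <=
    C * s xi `^ (m - 1) * \sum_i \sum_j xi i * xi j * a i j in
  0 < K -> (forall q : {ffun 'I_n -> rat}, ineq (fun i => ratr (q i))) ->
  forall xi, 0 < s xi -> ineq xi.
Proof.
move=> s ineq K0 Hq xi s0; have [q qxi] := rational_approximation xi.
have sq : s (fun i => ratr (q k i)) @[k --> \oo] --> s xi.
  by apply: cvg_sumr => i; rewrite expr2; apply: cvgM; exact: qxi.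
have vq : \sum_i ratr (q k i) * v i @[k --> \oo] --> \sum_i xi i * v i.
  by apply: cvg_sumr => i; apply: cvgMl; exact: qxi.
have lhs_cvg : (\sum_i ratr (q k i) * v i) ^+ 2 + K * s (fun i => ratr (q k i))
    @[k --> \oo] --> (\sum_i xi i * v i) ^+ 2 + K * s xi.
  rewrite expr2; under eq_cvg do rewrite expr2.
  by apply: cvgD; [apply: cvgM; exact: vq | apply: cvgMr; exact: sq].
have quad_cvg : \sum_i \sum_j ratr (q k i) * ratr (q k j) * a i j
    @[k --> \oo] --> \sum_i \sum_j xi i * xi j * a i j.
  apply: cvg_sumr => i; apply: cvg_sumr => j; apply: cvgMl.
  by apply: cvgM; exact: qxi.
apply: (@ler_cvg_to _ \oo _ _
  (fun k => ((\sum_i ratr (q k i) * v i) ^+ 2 + K * s (fun i => ratr (q k i))) `^ m)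
  (fun k => C * s (fun i => ratr (q k i)) `^ (m - 1) *
     \sum_i \sum_j ratr (q k i) * ratr (q k j) * a i j)).
- apply: (@continuous_cvg _ _ _ _ _ _ (fun y : R => y `^ m) _ _ lhs_cvg).
  by apply: powR_continuous; rewrite ltr_wpDl ?sqr_ge0// mulr_gt0.
- apply: cvgM quad_cvg; apply: cvgMr.
  by apply: (@continuous_cvg _ _ _ _ _ _ (fun y : R => y `^ (m - 1)) _ _ sq); exact: powR_continuous.
- by apply: nearW => k; exact: Hq.
Qed.

(** * Integrals and square-integrable functions *)

Section measure_theory.
Context d (T : measurableType d) (R : realType) (mu : {measure set T -> \bar R}).

Lemma integrable_sumr (n : nat) (f : 'I_n -> T -> R) :
  (forall i, mu.-integrable setT (EFin \o f i)) ->
  mu.-integrable setT (EFin \o (fun x => \sum_i f i x)).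
Proof.
move=> fi; rewrite (_ : _ \o _ = (fun x => \sum_i (f i x)%:E)%E).
  by apply: integrable_sum => // i _; exact: fi.
by apply/funext => x /=; rewrite -sumEFin.
Qed.

Lemma Rintegral_sumr (n : nat) (f : 'I_n -> T -> R) :
  (forall i, mu.-integrable setT (EFin \o f i)) ->
  \int[mu]_x (\sum_i f i x) = \sum_i \int[mu]_x f i x.
Proof.
elim: n f => [|n IH] f fi.
  under eq_Rintegral do rewrite big_ord0.
  by rewrite Rintegral_cst// mul0r big_ord0.
under eq_Rintegral do rewrite big_ord_recl.
rewrite RintegralD//; last exact: (integrable_sumr (f := fun i => f (lift ord0 i))).
by rewrite big_ord_recl (IH (fun i => f (lift ord0 i))).
Qed.

Lemma Rintegral_lincomb (n : nat) (c : 'I_n -> R) (f : 'I_n -> T -> R) :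
  (forall i, mu.-integrable setT (EFin \o f i)) ->
  \int[mu]_x (\sum_i c i * f i x) = \sum_i c i * \int[mu]_x f i x.
Proof.
move=> fi; rewrite Rintegral_sumr => [|i]; last first.
  exact: (integrableZl measurableT (c i) (fi i)).
by apply: eq_bigr => i _; rewrite RintegralZl.
Qed.

Lemma integrable_ae_le (f g : T -> R) : measurable_fun setT f ->
  {ae mu, forall x, `|f x| <= `|g x|} ->
  mu.-integrable setT (EFin \o g) -> mu.-integrable setT (EFin \o f).
Proof.
move=> mf fg /integrableP[mg gfin]; apply/integrableP; split.
  exact/measurable_EFinP.
apply: le_lt_trans gfin; apply: ae_ge0_le_integral => //.
- by apply: measurableT_comp => //; exact/measurable_EFinP.
- exact: measurableT_comp.
- by apply: filterS fg => x fgx _; rewrite /= lee_fin.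
Qed.

Lemma ae_le_Rintegral (f g : T -> R) :
  mu.-integrable setT (EFin \o f) -> mu.-integrable setT (EFin \o g) ->
  {ae mu, forall x, f x <= g x} -> \int[mu]_x f x <= \int[mu]_x g x.
Proof.
move=> fi gi fg; rewrite -subr_ge0 -RintegralB//.
have bi : mu.-integrable setT (EFin \o (fun x => g x - f x)).
  by rewrite (_ : _ \o _ = (EFin \o g) \- (EFin \o f))%E//; exact: integrableB.
rewrite [X in 0 <= X](_ : _ = \int[mu]_x `|g x - f x|).
  by apply: Rintegral_ge0 => x _.
congr fine; apply: ae_eq_integral => //.
- exact: measurable_int bi.
- apply/measurable_EFinP; apply: measurableT_comp => //.
  exact/measurable_EFinP/(measurable_int _ bi).
- by apply: filterS fg => x fgx _; rewrite ger0_norm// subr_ge0.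
Qed.

Lemma Lfun2_measurable (f : T -> R) : f \in Lfun mu 2%:E -> measurable_fun setT f.
Proof. by rewrite inE => /andP[/set_mem]. Qed.

Lemma Lfun2_mul_integrable (f g : T -> R) : f \in Lfun mu 2%:E ->
  g \in Lfun mu 2%:E -> mu.-integrable setT (EFin \o (fun x => f x * g x)).
Proof. by move=> f2 g2; apply/Lfun1_integrable; exact: Lfun2_mul_Lfun1. Qed.

Lemma Lfun2_lincomb (n : nat) (c : 'I_n -> R) (f : 'I_n -> T -> R) :
  (forall i, f i \in Lfun mu 2%:E) -> (fun x => \sum_i c i * f i x) \in Lfun mu 2%:E.
Proof.
move=> f2; elim: n c f f2 => [|n IH] c f f2.
  under eq_fun do rewrite big_ord0.
  by have [] := @Lfun_submod_closed _ _ _ mu _ (lee1n 2).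
under eq_fun do rewrite big_ord_recl.
have [_ Z] := @Lfun_submod_closed _ _ _ mu _ (lee1n 2).
exact: (Z (c ord0) (f ord0) _ (f2 _)
  (IH (fun i => c (lift ord0 i)) (fun i => f (lift ord0 i)) _)).
Qed.

Lemma sqr_Lnorm2 (f : T -> R) : f \in Lfun mu 2%:E ->
  fine 'N[mu]_2[EFin \o f] ^+ 2 = \int[mu]_x (f x ^+ 2).
Proof.
move=> f2; have f2fin : 'N[mu]_2[EFin \o f]%E \is a fin_num.
  rewrite ge0_fin_numE ?Lnorm_ge0//.
  by move: f2; rewrite inE => /andP[_ /set_mem].
have n2 : (2 : R) != 0 by rewrite pnatr_eq0.
have := powR_Lnorm mu (EFin \o f) n2; rewrite -[X in (X `^ _)%E]fineK//.
rewrite poweR_EFin powR_mulrn ?fine_ge0 ?Lnorm_ge0// => /(congr1 fine) /= ->.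
congr fine; apply: eq_integral => x _ /=.
by rewrite powR_mulrn// real_normK// num_real.
Qed.

Lemma Rintegral_sqr_eq0 (f : T -> R) : f \in Lfun mu 2%:E ->
  \int[mu]_x (f x ^+ 2) = 0 -> {ae mu, forall x, f x = 0}.
Proof.
move=> f2 I0; have fi := Lfun2_integrable_sqr f2.
have : (\int[mu]_x `|(f x ^+ 2)%:E| = 0)%E.
  under eq_integral do rewrite gee0_abs ?lee_fin ?sqr_ge0//.
  by rewrite -[LHS]fineK ?integrable_fin_num// -/(Rintegral _ _ _) I0.
move=> /(ae_eq_integral_abs mu measurableT (measurable_int _ fi)).
apply: filterS => x /(_ I) /= -[] /eqP; rewrite sqrf_eq0 => /eqP //.
Qed.

Lemma ess_sup_sqr_bound (f : T -> R) (B : R) : (0 < mu setT)%E ->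
  ('N[mu]_+oo[EFin \o f] ^+ 2 <= B%:E)%E -> {ae mu, forall x, f x ^+ 2 <= B}.
Proof.
move=> mu0 NB; near=> x; rewrite -lee_fin; apply: le_trans NB.
have fN : (`|(f x)%:E| <= 'N[mu]_+oo[EFin \o f])%E.
  by rewrite unlock mu0; near: x; exact: ess_sup_ge.
rewrite -[(f x)^+2]real_normK ?num_real// EFin_expe !expe2.
by apply: lee_pmul.
Unshelve. all: by end_near. Qed.

End measure_theory.

(** * Functions on the circle *)

(** Restated for this measure so that instance search finds it. *)
Lemma circle_ae_filter (R : realType) :
  Filter (almost_everywhere (@circle_measure R)).
Proof. exact: ae_filter_ringOfSetsType. Qed.

#[local] Hint Extern 0 (Filter (almost_everywhere _)) =>
  (exact: circle_ae_filter) : typeclass_instances.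
#[local] Hint Extern 0 (Filter (nbhs (almost_everywhere _))) =>
  (exact: circle_ae_filter) : typeclass_instances.

Section circle.
Context {R : realType}.
Implicit Types (f g V : R -> R) (l K : R).
Local Notation mu := (@circle_measure R).

Lemma circle_measureT : mu setT = (2 * pi)%:E.
Proof.
rewrite /circle_measure /=. rewrite /mrestr setTI lebesgue_measure_itv /=.
by rewrite lte_fin mulr_gt0 ?pi_gt0// oppr0 addr0.
Qed.

Lemma circle_measureT_gt0 : (0 < mu setT)%E.
Proof. by rewrite circle_measureT lte_fin mulr_gt0 ?pi_gt0. Qed.

Lemma circle_measureT_fin : mu setT \is a fin_num.
Proof. by rewrite circle_measureT. Qed.

Lemma ae_circle (P : R -> Prop) :
  (forall x, 0 < x < 2 * pi -> P x) -> {ae mu, forall x, P x}.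
Proof.
move=> HP; exists (~` `]0, 2 * pi[); split.
- by apply: measurableC; exact: measurable_itv.
- by rewrite /circle_measure /= /mrestr setICl measure0.
- by move=> x nPx /=; rewrite in_itv /= => /HP.
Qed.

Lemma circle_continuous_bounded g : continuous g ->
  exists B : R, {ae mu, forall x, `|g x| <= B}.
Proof.
move=> cg; have le0 : (0 : R) <= 2 * pi by rewrite mulr_ge0 ?pi_ge0.
have cng : continuous (fun x => `|g x|).
  by move=> x; apply: continuous_comp; [exact: cg | exact: norm_continuous].
have [c _ cmax] := EVT_max le0 (continuous_subspaceT cng).
exists `|g c|; apply: ae_circle => x /andP[x0 x1].
by apply: cmax; rewrite in_itv /= !ltW.
Qed.

Lemma integrable_mul_ae_bounded f g (B : R) :
  measurable_fun setT f -> measurable_fun setT g ->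
  {ae mu, forall x, `|g x| <= B} ->
  mu.-integrable setT (EFin \o f) ->
  mu.-integrable setT (EFin \o (fun x => f x * g x)).
Proof.
move=> mf mg gB fi.
apply: (integrable_ae_le (mu := mu) (f := fun x => f x * g x) (g := fun x => B * f x)).
- exact: measurable_funM.
- apply: filterS gB => x gB; rewrite !normrM mulrC ler_wpM2r//.
  exact: le_trans gB (ler_norm _).
- exact: (integrableZl measurableT B fi).
Qed.

Lemma Lfun2_integrable f : f \in Lfun mu 2%:E -> mu.-integrable setT (EFin \o f).
Proof.
by move=> f2; apply/Lfun1_integrable/Lfun_subset12; rewrite ?circle_measureT_fin.
Qed.

Lemma Lfun2_mul_continuous f g : f \in Lfun mu 2%:E -> continuous g ->
  mu.-integrable setT (EFin \o (fun x => f x * g x)).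
Proof.
move=> f2 cg; have [B gB] := circle_continuous_bounded cg.
apply: (integrable_mul_ae_bounded _ _ gB).
- exact: Lfun2_measurable f2.
- exact: continuous_measurable_fun.
- exact: Lfun2_integrable.
Qed.

Lemma Rintegral_lincomb_mul (n : nat) (c : 'I_n -> R) (f : 'I_n -> R -> R) g :
  (forall i, mu.-integrable setT (EFin \o (fun x => f i x * g x))) ->
  \int[mu]_x ((\sum_i c i * f i x) * g x) = \sum_i c i * \int[mu]_x (f i x * g x).
Proof.
move=> fi; rewrite -Rintegral_lincomb//; apply: eq_Rintegral => x _.
by rewrite mulr_suml; apply: eq_bigr => i _; rewrite mulrA.
Qed.

Lemma smooth_periodic_continuous g (n : nat) :
  smooth_periodic g -> continuous (derive1n n g).
Proof.
by case=> _ dg x; apply: differentiable_continuous; apply/derivable1_diffP; exact: dg.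
Qed.

Lemma Lper2_lincomb (n : nat) (c : 'I_n -> R) (f : 'I_n -> R -> R) :
  (forall i, Lper 2 (f i)) -> Lper 2 (fun x => \sum_i c i * f i x).
Proof.
move=> fP; split; last by apply: Lfun2_lincomb => i; have [] := fP i.
by move=> x; apply: eq_bigr => i _; have [-> _] := fP i.
Qed.

Lemma L2dot_lincomb (n : nat) (c : 'I_n -> R) (f : 'I_n -> R -> R) :
  (forall i, L2dot (f i)) -> L2dot (fun x => \sum_i c i * f i x).
Proof.
move=> fP; split; first by apply: Lper2_lincomb => i; have [] := fP i.
rewrite Rintegral_lincomb => [|i]; last first.
  by apply: Lfun2_integrable; have [[]] := fP i.
by rewrite big1// => i _; have [_ ->] := fP i; rewrite mulr0.
Qed.

(** Each test function is continuous, hence bounded on the period, so its products with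
    square-integrable functions are integrable and both sides of the defining identities
    are linear. *)
Lemma sobolev_deriv_lincomb l (n : nat) (c : 'I_n -> R) (f df : 'I_n -> R -> R) :
  (forall i, Lper 2 (f i)) -> (forall i, sobolev_deriv l (f i) (df i)) ->
  sobolev_deriv l (fun x => \sum_i c i * f i x) (fun x => \sum_i c i * df i x).
Proof.
move=> f2 fd; split; first by apply: Lper2_lincomb => i; have [] := fd i.
have fL i : f i \in Lfun mu 2%:E by have [] := f2 i.
have dL i : df i \in Lfun mu 2%:E by have [[]] := fd i.
case: ifPn => lnat.
  move=> psi psiP; rewrite !Rintegral_lincomb_mul.
  - rewrite mulr_sumr; apply: eq_bigr => i _.
    by have [_] := fd i; rewrite lnat => ->//; rewrite mulrCA.
  - by move=> i; apply: Lfun2_mul_continuous => //; exact: smooth_periodic_continuous.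
  - move=> i; apply: Lfun2_mul_continuous => //.
    exact: (@smooth_periodic_continuous _ 0%N).
move=> k.
have lin (trig : R -> R) : continuous trig ->
    (forall i, \int[mu]_x (df i x * trig (k%:R * x)) =
       (k%:R ^+ 2) `^ (l / 2) * \int[mu]_x (f i x * trig (k%:R * x))) ->
    \int[mu]_x ((\sum_i c i * df i x) * trig (k%:R * x)) =
    (k%:R ^+ 2) `^ (l / 2) * \int[mu]_x ((\sum_i c i * f i x) * trig (k%:R * x)).
  move=> ct Hi; have ck : continuous (fun x : R => trig (k%:R * x)).
    by move=> x; apply: continuous_comp; [exact: mulrl_continuous | exact: ct].
  rewrite !(@Rintegral_lincomb_mul _ _ _ (fun x : R => trig (k%:R * x))).
  - by rewrite mulr_sumr; apply: eq_bigr => i _; rewrite Hi mulrCA.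
  - by move=> i; exact: Lfun2_mul_continuous.
  - by move=> i; exact: Lfun2_mul_continuous.
split.
  apply: lin => [|i]; first exact: continuous_cos.
  by have [_] := fd i; rewrite (negbTE lnat) => /(_ k)[].
apply: lin => [|i]; first exact: continuous_sin.
by have [_] := fd i; rewrite (negbTE lnat) => /(_ k)[].
Qed.

Lemma Hdot_Lfun2 l f : Hdot l f -> f \in Lfun mu 2%:E.
Proof. by case=> -[[]]. Qed.

Lemma Hdot_lincomb l (n : nat) (c : 'I_n -> R) (f df : 'I_n -> R -> R) :
  (forall i, Hdot l (f i)) -> (forall i, sobolev_deriv l (f i) (df i)) ->
  Hdot l (fun x => \sum_i c i * f i x).
Proof.
move=> fH fd; split; first by apply: L2dot_lincomb => i; have [] := fH i.
exists (fun x => \sum_i c i * df i x); apply: sobolev_deriv_lincomb => // i.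
by have [[]] := fH i.
Qed.

(** The right-hand side of the one-function inequality is a finite bound for the essential
    supremum of [f ^ 2]. *)
Lemma Hdot_ae_bounded l K f : sup_inequality l K -> Hdot l f ->
  exists B : R, {ae mu, forall x, `|f x| <= B}.
Proof.
move=> hK fH; have [_ [df fd]] := fH.
have /(ess_sup_sqr_bound circle_measureT_gt0) := hK f df fH fd.
set B := (X in forall x, _ <= X); move=> fB; exists (Num.sqrt B).
by apply: filterS fB => x fB; rewrite -sqrtr_sqr ler_wsqrtr.
Qed.

(** [V] is integrable because the period has finite measure, and [f], [g] are bounded. *)
Lemma integrable_potential l K V f g (p : R) : 1 <= p -> sup_inequality l K ->
  Lper p V -> Hdot l f -> Hdot l g ->
  mu.-integrable setT (EFin \o (fun x => V x * f x * g x)).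
Proof.
move=> p1 hK [_ Vp] fH gH.
have [B fB] := Hdot_ae_bounded hK fH; have [C gC] := Hdot_ae_bounded hK gH.
have Vi : mu.-integrable setT (EFin \o V).
  have p1E : (1 <= p%:E)%E by rewrite lee_fin.
  apply/Lfun1_integrable.
  exact: (Lfun_subset (lexx _) p1E circle_measureT_fin p1E Vp).
have mV : measurable_fun setT V by move: Vp; rewrite inE => /andP[/set_mem].
have mf := Lfun2_measurable (Hdot_Lfun2 fH).
have mg := Lfun2_measurable (Hdot_Lfun2 gH).
apply: (integrable_mul_ae_bounded _ mg gC); first exact: measurable_funM.
exact: (integrable_mul_ae_bounded mV mf fB).
Qed.

End circle.

(** * Orthonormal eigenfunctions *)

Section spectral.
Context {R : realType}.
Implicit Types (f g V : R -> R) (l K lam p : R).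
Local Notation mu := (@circle_measure R).

(** The weak eigenvalue equation with an explicit choice [df] of the derivative of [f], so
    that linear combinations act on [f] and [df] by the same coefficients. *)
Definition eigenpair l V lam f df :=
  [/\ Hdot l f, sobolev_deriv l f df &
    forall psi dpsi, Hdot l psi -> sobolev_deriv l psi dpsi ->
      schroedinger_form V f df psi dpsi = lam * \int[mu]_x (f x * psi x)].

Definition orthonormal (n : nat) (f : 'I_n -> R -> R) :=
  forall i j, \int[mu]_x (f i x * f j x) = (i == j)%:R.

Lemma eigenpair_schroedinger_op l V lam f :
  schroedinger_op l V f (fun x => lam * f x) -> exists df, eigenpair l V lam f df.
Proof.
case=> fH _ [df fd form]; exists df; split=> // psi dpsi psiH psid.
rewrite (form psi dpsi psiH psid) -RintegralZl//.
  by apply: eq_Rintegral => x _; rewrite mulrA.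
exact: Lfun2_mul_integrable (Hdot_Lfun2 fH) (Hdot_Lfun2 psiH).
Qed.

Lemma sobolev_deriv_Lfun2 l f df : sobolev_deriv l f df -> df \in Lfun mu 2%:E.
Proof. by case=> -[]. Qed.

Lemma eigenpair_lincomb l K p V lam (n : nat) (c : 'I_n -> R) (f df : 'I_n -> R -> R) :
  1 <= p -> sup_inequality l K -> Lper p V ->
  (forall i, eigenpair l V lam (f i) (df i)) ->
  eigenpair l V lam (fun x => \sum_i c i * f i x) (fun x => \sum_i c i * df i x).
Proof.
move=> p1 hK VP fe.
have fH i : Hdot l (f i) by have [] := fe i.
have fd i : sobolev_deriv l (f i) (df i) by have [] := fe i.
split; first exact: Hdot_lincomb fH fd.
  by apply: sobolev_deriv_lincomb => // i; have [[]] := fH i.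
move=> psi dpsi psiH psid; rewrite /schroedinger_form.
have psi2 := Hdot_Lfun2 psiH; have dpsi2 := sobolev_deriv_Lfun2 psid.
rewrite !(@Rintegral_lincomb_mul _ _ c); last 2 first.
- by move=> i; apply: Lfun2_mul_integrable psi2; exact: Hdot_Lfun2.
- by move=> i; apply: Lfun2_mul_integrable dpsi2; exact: sobolev_deriv_Lfun2 (fd i).
have -> : \int[mu]_x (V x * (\sum_i c i * f i x) * psi x) =
    \sum_i c i * \int[mu]_x (V x * f i x * psi x).
  rewrite -(@Rintegral_lincomb_mul _ _ c (fun i x => V x * f i x)); last first.
    by move=> i; exact: integrable_potential p1 hK VP (fH i) psiH.
  apply: eq_Rintegral => x _; congr (_ * _); rewrite mulr_sumr.
  by apply: eq_bigr => i _; rewrite mulrCA.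
rewrite -sumrB mulr_sumr; apply: eq_bigr => i _.
by have [_ _ /(_ psi dpsi psiH psid) form] := fe i; rewrite -mulrBr [RHS]mulrCA -form.
Qed.

(** The form at [(f, g)] equals both [lam] and [nu] times the inner product. *)
Lemma eigenpair_orthogonal l V lam nu f df g dg :
  eigenpair l V lam f df -> eigenpair l V nu g dg -> lam != nu ->
  \int[mu]_x (f x * g x) = 0.
Proof.
move=> [fH fd ff] [gH gd gg] neq; have := ff g dg gH gd; have := gg f df fH fd.
rewrite (_ : schroedinger_form V g dg f df = schroedinger_form V f df g dg); last first.
  rewrite /schroedinger_form; congr (_ - _); apply: eq_Rintegral => x _.
    by rewrite mulrC.
  by rewrite mulrAC.
rewrite (_ : \int[mu]_x (g x * f x) = \int[mu]_x (f x * g x)); last first.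
  by apply: eq_Rintegral => x _; rewrite mulrC.
move=> -> /eqP; rewrite eq_sym -subr_eq0 -mulrBl mulf_eq0 subr_eq0.
by rewrite (negbTE neq) => /eqP.
Qed.

Lemma Rintegral_lincomb2 (n : nat) (c e : 'I_n -> R) (f g : 'I_n -> R -> R) :
  (forall i, f i \in Lfun mu 2%:E) -> (forall i, g i \in Lfun mu 2%:E) ->
  \int[mu]_x ((\sum_i c i * f i x) * (\sum_j e j * g j x)) =
  \sum_i \sum_j c i * e j * \int[mu]_x (f i x * g j x).
Proof.
move=> f2 g2; rewrite Rintegral_lincomb_mul => [|i]; last first.
  by apply: Lfun2_mul_integrable => //; exact: Lfun2_lincomb.
apply: eq_bigr => i _; under eq_Rintegral do rewrite mulrC.
rewrite Rintegral_lincomb_mul => [|j]; last exact: Lfun2_mul_integrable.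
rewrite mulr_sumr; apply: eq_bigr => j _; rewrite mulrA; congr (_ * _).
by apply: eq_Rintegral => x _; rewrite mulrC.
Qed.

(** Independence almost everywhere says that the Gram matrix is positive definite, which
    is what the Gram-Schmidt step needs. *)
Lemma orthonormalize (n : nat) (phi : 'I_n -> R -> R) :
  (forall i, phi i \in Lfun mu 2%:E) -> ae_independent phi ->
  exists P : 'M[R]_n, orthonormal (fun j x => \sum_i P j i * phi i x).
Proof.
move=> phi2 indep; pose G := \matrix_(i, j) \int[mu]_x (phi i x * phi j x).
have quad (u v : 'rV[R]_n) : (u *m G *m v^T) 0 0 =
    \int[mu]_x ((\sum_i u 0 i * phi i x) * (\sum_j v 0 j * phi j x)).
  rewrite Rintegral_lincomb2// mxE exchange_big /=; apply: eq_bigr => j _.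
  rewrite !mxE mulr_suml; apply: eq_bigr => i _; rewrite !mxE; ring.
have [|x xN0|P PGP] := @gram_schmidt _ _ G.
- apply/matrixP => i j; rewrite !mxE; apply: eq_Rintegral => x _; exact: mulrC.
- rewrite quad; under eq_Rintegral do rewrite -expr2.
  rewrite lt_def Rintegral_ge0 ?andbT; last by move=> *; exact: sqr_ge0.
  apply: contraNneq xN0 => /Rintegral_sqr_eq0 h.
  have /indep x0 := h (Lfun2_lincomb _ phi2).
  by apply/eqP/rowP => i; rewrite mxE x0.
- exists P => i j.
  have -> : (i == j)%:R = (row i P *m G *m (row j P)^T) 0 0.
    have := congr1 (fun M : 'M[R]_n => M i j) PGP; rewrite [RHS]mxE => <-.
    rewrite !mxE; apply: eq_bigr => k _; rewrite !mxE; congr (_ * _).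
    by apply: eq_bigr => m _; rewrite !mxE.
  rewrite quad; apply: eq_Rintegral => x _.
  by congr (_ * _); apply: eq_bigr => k _; rewrite mxE.
Qed.

Lemma eigenspace_orthonormal_basis l K p V lam (n : nat) :
  1 <= p -> sup_inequality l K -> Lper p V -> multiplicity_ge l V lam n ->
  exists f df : 'I_n -> R -> R,
    (forall i, eigenpair l V lam (f i) (df i)) /\ orthonormal f.
Proof.
move=> p1 hK VP [phi [phi_op indep]].
have /choice[dphi phiE] i := eigenpair_schroedinger_op (phi_op i).
have phi2 i : phi i \in Lfun mu 2%:E by have [/Hdot_Lfun2] := phiE i.
have [P PO] := orthonormalize phi2 indep.
exists (fun j x => \sum_i P j i * phi i x), (fun j x => \sum_i P j i * dphi i x).
by split=> // j; exact: eigenpair_lincomb p1 hK VP phiE.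
Qed.

(** A value listed [n] times has [n] orthonormal eigenfunctions; the index [j] receives the
    one whose number is the rank of [j] among the indices with the same value. *)
Lemma orthonormal_eigenfunctions l K p V (N : nat) (lam : 'I_N -> R) :
  1 <= p -> sup_inequality l K -> Lper p V -> eigenvalues_with_mult l V lam ->
  exists f df : 'I_N -> R -> R,
    (forall j, eigenpair l V (lam j) (f j) (df j)) /\ orthonormal f.
Proof.
move=> p1 hK VP mult.
pose A (v : R) := [set i | lam i == v]%SET.
(* The basis is chosen as a function of the eigenvalue, so that equal entries of the
   list share it; indexing by [nat] avoids a dependence of types on the value. *)
have /choice[F FP] : forall v : R, exists F : nat -> (R -> R) * (R -> R),
    (exists j, lam j = v) ->
    (forall a, (a < #|A v|)%N -> eigenpair l V v (F a).1 (F a).2) /\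
    (forall a b, (a < #|A v|)%N -> (b < #|A v|)%N ->
       \int[mu]_x ((F a).1 x * (F b).1 x) = (a == b)%:R).
  move=> v; have [[j jv]|nv] := pselect (exists j, lam j = v); last first.
    by exists (fun=> (fun=> 0, fun=> 0)) => /nv.
  have := mult j; rewrite jv -/(A v) => /(eigenspace_orthonormal_basis p1 hK VP).
  move=> [f [df [fE fO]]]; have [i0 _] : exists i : 'I_(#|A v|), true.
    suff lt0 : (0 < #|A v|)%N by exists (Ordinal lt0).
    by apply/card_gt0P; exists j; rewrite inE jv.
  exists (fun a => (f (insubd i0 a), df (insubd i0 a))) => _; split=> [a _|a b aA bA].
    exact: fE.
  by rewrite fO -val_eqE !val_insubd aA bA.
pose r j := index j (enum (A (lam j))).
have rlt j : (r j < #|A (lam j)|)%N by rewrite cardE index_mem mem_enum inE.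
exists (fun j => (F (lam j) (r j)).1), (fun j => (F (lam j) (r j)).2); split.
  by move=> j; have [+ _] := FP _ (ex_intro _ j erefl); apply.
have FE j : eigenpair l V (lam j) (F (lam j) (r j)).1 (F (lam j) (r j)).2.
  by have [+ _] := FP _ (ex_intro _ j erefl); apply.
move=> j k; have [ljk|ljk] := eqVneq (lam j) (lam k); last first.
  rewrite (eigenpair_orthogonal (FE j) (FE k) ljk).
  by case: (eqVneq j k) ljk => [->|//]; rewrite eqxx.
have [_ FO] := FP _ (ex_intro _ k erefl).
have rltj : (r j < #|A (lam k)|)%N by rewrite -ljk.
rewrite ljk FO//; congr (nat_of_bool _)%:R; apply/eqP/eqP => [|-> //].
rewrite /r ljk => rE.
have jA : j \in enum (A (lam k)) by rewrite mem_enum inE ljk.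
have kA : k \in enum (A (lam k)) by rewrite mem_enum inE.
by rewrite -(nth_index j jA) rE nth_index.
Qed.

End spectral.

(** * The pointwise inequality for the density *)

Section density.
Context {R : realType}.
Implicit Types (f g V : R -> R) (l K lam p : R).
Local Notation mu := (@circle_measure R).

Lemma ae_forall_count (I : countType) (P : I -> R -> Prop) :
  (forall i, {ae mu, forall x, P i x}) -> {ae mu, forall x, forall i, P i x}.
Proof.
move=> aeP; have := @ae_foralln _ _ _ mu
  (fun n x => if unpickle n is Some i then P i x else True).
have H n : {ae mu, forall x, if unpickle n is Some i then P i x else True}.
  by case: unpickle => [i|]; [exact: aeP | exact: aeW].
move=> /(_ H); apply: filterS => x Hx i.
by have := Hx (pickle i); rewrite pickleK.
Qed.

Lemma c_const_gt0 l : 1 / 2 < l -> 0 < c_const l :> R.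
Proof.
move=> hl; rewrite /c_const /=; set a := 1 / (2 * l).
have l2 : 1 < 2 * l by lra.
have a0 : 0 < a by rewrite divr_gt0//; lra.
have a1 : a < 1 by rewrite ltr_pdivrMr; lra.
rewrite invr_gt0 !mulr_gt0 ?powR_gt0 ?subr_gt0//; first lra.
apply: sin_gt0_pi; rewrite mulr_gt0 ?pi_gt0//= -[ltRHS]mulr1.
by rewrite ltr_pM2l ?pi_gt0.
Qed.

(** The power [2 l] makes the right-hand side linear in the squared norm of [df], so that
    for [f = \sum_i xi i * phi_i] it becomes a quadratic form in [xi]. *)
Lemma sup_inequality_powR l K f df : 1 / 2 < l -> 0 < K -> sup_inequality l K ->
  Hdot l f -> sobolev_deriv l f df ->
  {ae mu, forall x, (f x ^+ 2 + K * \int[mu]_x (f x ^+ 2)) `^ (2 * l) <=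
    c_const l `^ (2 * l) * (\int[mu]_x (f x ^+ 2)) `^ (2 * l - 1) *
    \int[mu]_x (df x ^+ 2)}.
Proof.
move=> hl K0 hK fH fd; have f2 := Hdot_Lfun2 fH; have df2 := sobolev_deriv_Lfun2 fd.
rewrite -(sqr_Lnorm2 f2) -(sqr_Lnorm2 df2) -/(L2norm f) -/(L2norm df).
have A0 : 0 <= L2norm f by rewrite fine_ge0 ?Lnorm_ge0.
have D0 : 0 <= L2norm df by rewrite fine_ge0 ?Lnorm_ge0.
have c0 := c_const_gt0 hl; have l0 : l != 0 by lra.
have := ess_sup_sqr_bound circle_measureT_gt0 (hK f df fH fd).
apply: filterS => x; rewrite lerBrDr => fx.
have m0 : 0 <= 2 * l by lra.
apply: le_trans (ge0_ler_powR m0 _ _ fx) _.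
- by rewrite nnegrE addr_ge0 ?sqr_ge0// mulr_ge0 ?sqr_ge0// ltW.
- by rewrite nnegrE !mulr_ge0 ?powR_ge0// ltW.
rewrite (@powRM _ (_ * _)) ?mulr_ge0 ?powR_ge0 ?(ltW c0)//.
rewrite powRM ?powR_ge0 ?(ltW c0)// -!powRrM -!powR_mulrn// -!powRrM.
rewrite (_ : (2 - 1 / l) * (2 * l) = 2 * (2 * l - 1)); last by field.
by rewrite (_ : 1 / l * (2 * l) = 2) //; field.
Qed.

(** The inequality for the combination with coefficients [xi i = f i x]. Rational [xi] come
    first, so that a single null set serves all of them. *)
Lemma density_inequality l K (n : nat) (f df : 'I_n -> R -> R) :
  1 / 2 < l -> 0 < K -> sup_inequality l K ->
  (forall i, Hdot l (f i)) -> (forall i, sobolev_deriv l (f i) (df i)) ->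
  orthonormal f ->
  {ae mu, forall x,
    (\sum_i f i x ^+ 2) * (\sum_i f i x ^+ 2 + K) `^ (2 * l) <= c_const l `^ (2 * l) *
      \sum_i \sum_j f i x * f j x * \int[mu]_x (df i x * df j x)}.
Proof.
move=> hl K0 hK fH fd fO.
have f2 i := Hdot_Lfun2 (fH i); have df2 i := sobolev_deriv_Lfun2 (fd i).
have norm_comb (xi : 'I_n -> R) :
    \int[mu]_x ((\sum_i xi i * f i x) ^+ 2) = \sum_i xi i ^+ 2.
  under eq_Rintegral do rewrite expr2.
  rewrite Rintegral_lincomb2//; apply: eq_bigr => i _.
  rewrite (bigD1 i)//= fO eqxx mulr1 big1 ?addr0// => j ji.
  by rewrite fO eq_sym (negbTE ji) mulr0.
have dnorm_comb (xi : 'I_n -> R) : \int[mu]_x ((\sum_i xi i * df i x) ^+ 2) =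
    \sum_i \sum_j xi i * xi j * \int[mu]_x (df i x * df j x).
  by under eq_Rintegral do rewrite expr2; rewrite Rintegral_lincomb2.
have : {ae mu, forall x, forall q : {ffun 'I_n -> rat},
    ((\sum_i ratr (q i) * f i x) ^+ 2 + K * \sum_i ratr (q i) ^+ 2) `^ (2 * l) <=
    c_const l `^ (2 * l) * (\sum_i ratr (q i) ^+ 2) `^ (2 * l - 1) *
    \sum_i \sum_j ratr (q i) * ratr (q j) * \int[mu]_x (df i x * df j x)}.
  apply: ae_forall_count => q; rewrite -norm_comb -dnorm_comb.
  apply: sup_inequality_powR => //; first exact: Hdot_lincomb fH fd.
  by apply: sobolev_deriv_lincomb => // i; have [[]] := fH i.
apply: filterS => x Hx; set rho := \sum_i f i x ^+ 2.
have rho_ge0 : 0 <= rho by apply: sumr_ge0 => i _; exact: sqr_ge0.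
(* A power of [rho] is cancelled at the end, so the zeros of [rho] are set apart. *)
have := rho_ge0; rewrite le_eqVlt => /predU1P[rho0|rho_gt0].
  have fx0 i : f i x = 0.
    move/esym/eqP: rho0; rewrite psumr_eq0 => [|j _]; last exact: sqr_ge0.
    by move=> /allP/(_ i (mem_index_enum i)) /=; rewrite sqrf_eq0 => /eqP.
  rewrite -rho0 mul0r big1 ?mulr0// => i _; rewrite big1// => j _.
  by rewrite fx0 !mul0r.
have /= := rational_directions K0 Hx rho_gt0; rewrite -/rho => h.
have factor : (rho ^+ 2 + K * rho) `^ (2 * l) =
    rho `^ (2 * l - 1) * (rho * (rho + K) `^ (2 * l)).
  rewrite mulrA (mulrC (rho `^ _)) mulr_powRB1//; last lra.
  by rewrite -powRM ?addr_ge0// ?(ltW K0)// mulrDr expr2 [rho * K]mulrC.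
have pow_gt0 : 0 < rho `^ (2 * l - 1) by rewrite powR_gt0.
by rewrite -(ler_pM2l pow_gt0) -factor [leRHS]mulrA (mulrC (rho `^ _)).
Qed.

End density.

(** * The trace bound *)

Unset Implicit Arguments.

Theorem theorem3p2 (R : realType) (l : R) (K : R) (V : R -> R)
    (N : nat) (nu : 'I_N -> R)
    (hl : 1 / 2 < l)
    (hK : is_sharp_const l K)
    (V_ge0 : {ae circle_measure, forall x : R, 0 <= V x})
    (V_Lp : Lper ((2 * l + 1) / (2 * l)) V)
    (nu_ge0 : forall j, 0 <= nu j)
    (hnu : eigenvalues_with_mult l V (fun j => - nu j)) :
  \sum_(j < N) nu j + N%:R * (K / c_const l) `^ (2 * l) <=
    2 * l / (2 * l + 1) `^ ((2 * l + 1) / (2 * l)) * c_const l *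
    \int[circle_measure]_x V x `^ ((2 * l + 1) / (2 * l)).
Proof.
have [K0 hsup _] := hK; set p := (2 * l + 1) / (2 * l) in V_Lp *.
have p1 : 1 <= p by rewrite ler_pdivlMr; lra.
have c0 := c_const_gt0 hl; set c := c_const l in c0 *.
have [f [df [fE fO]]] := orthonormal_eigenfunctions p1 hsup V_Lp hnu.
have fH j : Hdot l (f j) by have [] := fE j.
have fd j : sobolev_deriv l (f j) (df j) by have [] := fE j.
pose a i j := \int[circle_measure]_x (df i x * df j x).
have ff_int i j : circle_measure.-integrable setT (EFin \o (fun x => f i x * f j x)).
  by apply: Lfun2_mul_integrable; exact: Hdot_Lfun2.
have Vff_int j : circle_measure.-integrable setT (EFin \o (fun x => V x * f j x * f j x)).
  exact: integrable_potential p1 hsup V_Lp (fH j) (fH j).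
have Vp_int : circle_measure.-integrable setT (EFin \o (fun x => `|V x| `^ p)).
  by apply: Lfun_integrable => //; have [] := V_Lp.
set C := 2 * l / _ * c; pose k := (K / c) `^ (2 * l).
(* Orthonormality makes [- nu j] the value of the form at [f j]. *)
have form j : nu j = \int[circle_measure]_x (V x * f j x * f j x) - a j j.
  have [_ _ /(_ _ _ (fH j) (fd j))] := fE j.
  rewrite /schroedinger_form fO eqxx mulr1 => e; rewrite /a -[LHS]opprK -e; lra.
(* [`|V x|] agrees with [V x] almost everywhere, and its power is integrable. *)
have pointwise : {ae circle_measure, forall x,
    \sum_j V x * f j x * f j x + \sum_j k * (f j x * f j x) <=
    C * `|V x| `^ p + \sum_i \sum_j a i j * (f i x * f j x)}.
  have := density_inequality hl K0 hsup fH fd fO.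
  apply: filterS2 V_ge0 => x V0.
  set rho := \sum_i f i x ^+ 2 => dens.
  have rho0 : 0 <= rho by apply: sumr_ge0 => i _; exact: sqr_ge0.
  have -> : \sum_j V x * f j x * f j x = V x * rho.
    by rewrite mulr_sumr; apply: eq_bigr => j _; rewrite -mulrA expr2.
  have -> : \sum_j k * (f j x * f j x) = k * rho.
    by rewrite mulr_sumr; apply: eq_bigr => j _; rewrite expr2.
  have := young_potential hl c0 V0 rho0; rewrite -/p -/C ger0_norm// => young.
  apply: le_trans (lerD young (lexx _)) _; rewrite -addrA lerD2l.
  have cm0 : 0 < c `^ (2 * l) by rewrite powR_gt0.
  have m1 : 1 < 2 * l by lra.
  have kE : c `^ (2 * l) * (k * rho) = K `^ (2 * l) * rho.
    have -> : K = (K / c) * c by rewrite divfK ?gt_eqF.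
    by rewrite (powRM _ (divr_ge0 (ltW K0) (ltW c0)) (ltW c0)) mulrA [_ * k]mulrC.
  rewrite -(ler_pM2l cm0) mulrDr mulrA mulfV ?gt_eqF// mul1r kE.
  rewrite (_ : rho `^ (2 * l + 1) = rho * rho `^ (2 * l)); last first.
    by rewrite -[in LHS](mulr_powRB1 rho0) ?addrK//; lra.
  rewrite [K `^ _ * rho]mulrC -mulrDr.
  apply: le_trans (ler_wpM2l rho0 (powR_superadd m1 rho0 (ltW K0))) _.
  apply: le_trans dens _; rewrite le_eqVlt; apply/predU1P; left; congr (_ * _).
  by apply: eq_bigr => i _; apply: eq_bigr => j _; rewrite mulrC.
have scaled_int (r : R) (h : R -> R) : circle_measure.-integrable setT (EFin \o h) ->
    circle_measure.-integrable setT (EFin \o (fun x => r * h x)).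
  exact: integrableZl.
have lhs1_int := integrable_sumr Vff_int.
have lhs2_int := integrable_sumr (fun j => scaled_int k _ (ff_int j j)).
have rhs1_int := scaled_int C _ Vp_int.
have quad_int i := integrable_sumr (fun j => scaled_int (a i j) _ (ff_int i j)).
have rhs2_int := integrable_sumr quad_int.
have := ae_le_Rintegral (integrableD measurableT lhs1_int lhs2_int)
  (integrableD measurableT rhs1_int rhs2_int) pointwise.
rewrite (RintegralD measurableT lhs1_int lhs2_int).
rewrite (RintegralD measurableT rhs1_int rhs2_int).
rewrite Rintegral_sumr// Rintegral_lincomb// RintegralZl// Rintegral_sumr//.
have -> : \int[circle_measure]_x `|V x| `^ p = \int[circle_measure]_x V x `^ p.
  have mV : measurable_fun setT V by have [_] := V_Lp; rewrite inE => /andP[/set_mem].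
  congr fine; apply: ae_eq_integral => //.
  - exact: measurable_int Vp_int.
  - by apply/measurable_EFinP; exact: (measurableT_comp (measurable_powR p) mV).
  - by apply: filterS V_ge0 => x V0 _; rewrite ger0_norm.
have -> : \sum_j k * \int[circle_measure]_x (f j x * f j x) = N%:R * k.
  under eq_bigr do rewrite fO eqxx mulr1.
  by rewrite sumr_const card_ord mulr_natl.
have -> : \sum_i \int[circle_measure]_x (\sum_j a i j * (f i x * f j x)) =
    \sum_i a i i.
  apply: eq_bigr => i _; rewrite Rintegral_lincomb// (bigD1 i)//= fO eqxx mulr1.
  rewrite big1 ?addr0// => j ji; by rewrite fO eq_sym (negbTE ji) mulr0.
under [\sum_j nu j]eq_bigr do rewrite form.
rewrite sumrB /k; lra.
Qed.
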